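(* Let $S$ be one of $\mathbb{E}^2$, $\mathbb{S}^2_+$, $\mathbb{H}^2_+$, let $\Gamma_0\subset S$ be the geodesic circle of radius $\rho_0>0$ (with $\rho_0<\pi/2$ if $S=\mathbb{S}^2_+$), and let $\Gamma_\epsilon\subset S$ be the perturbed curve given in geodesic polar coordinates by $\rho=\rho_\epsilon(\theta)=\rho_0+\epsilon\rho_1(\theta)+O(\epsilon^2)$, with billiard map $f_\epsilon$. Write the Fourier expansion $\rho_1(\theta)=\sum_{j\in\mathbb{Z}}c_j e^{ij\theta}$. Let $m,n$ be integers with $n\ge 2$, $0<m<n$, $\gcd(m,n)=1$, and let $\Upsilon_0^{\frac{m}{n}}$ be the $(m,n)$-resonant horizontal rotational invariant circle of $f_0$. If there exists $j\in n\mathbb{Z}$ such that $c_j\neq 0$, then $\Upsilon_0^{\frac{m}{n}}$ breaks up under $f_\epsilon$, i.e. $\Upsilon_0^{\frac{m}{n}}$ does not persist under the perturbation $f_\epsilon$.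
   Context: Surfaces. $\mathbb{E}^2\subset\mathbb{R}^3$ is parametrized by $(\rho\cos\theta,\rho\sin\theta,1)$, $\rho\ge 0$; $\mathbb{S}^2_+\subset\mathbb{R}^3$ (an open hemisphere of the unit sphere) by $(\sin\rho\cos\theta,\sin\rho\sin\theta,\cos\rho)$, $0\le\rho<\pi/2$; $\mathbb{H}^2_+\subset\mathbb{R}^{2,1}$ (upper sheet of the hyperboloid) by $(\sinh\rho\cos\theta,\sinh\rho\sin\theta,\cosh\rho)$, $\rho\ge 0$. These are geodesic polar coordinates $(\rho,\theta)$; each surface carries its standard metric of curvature $0,1,-1$ respectively. The curve ''$\rho=\rho(\theta)$'' is the closed curve $\Gamma(\theta)$, $\theta\in\mathbb{T}=\mathbb{R}/2\pi\mathbb{Z}$, obtained by putting $\rho=\rho(\theta)$ in the parametrization. Perturbation. $\rho_\epsilon(\theta)$ is real-valued, smooth in $(\theta,\epsilon)$ and $2\pi$-periodic in $\theta$; $\epsilon$ is small enough that $\Gamma_\epsilon$ is an oval, i.e. a closed, simple, regular curve with strictly positive geodesic curvature (ovals are geodesically strictly convex: any geodesic meets them at most twice). Billiard map. For an oval $\Gamma$ bounding a region $\Omega$ containing the pole $\rho=0$, a particle moves along geodesics inside $\Omega$ and reflects elastically (equal angles with the tangent) at $\Gamma$. The billiard map $f:\mathbb{T}\times(0,\pi)\to\mathbb{T}\times(0,\pi)$, $(\theta_0,\psi_0)\mapsto(\theta_1,\psi_1)$, sends an impact point $\Gamma(\theta_0)$ and the angle $\psi_0$ between the tangent $\Gamma'(\theta_0)$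 and the outgoing direction to the next impact point $\Gamma(\theta_1)$ and the outgoing angle $\psi_1$ after that reflection. Its lift $\tilde f$ to $\mathbb{R}\times(0,\pi)$ is chosen so that $\theta_1-\theta_0\in(0,2\pi)$. The billiard map of $\Gamma_\epsilon$ is $f_\epsilon$. Invariant circles. A rotational invariant circle (RIC) of $f$ is a homotopically nontrivial closed curve $\Upsilon\subset\mathbb{T}\times(0,\pi)$ with $f(\Upsilon)=\Upsilon$. A periodic point of least period $n$ is of type $(m,n)$ if $\tilde f^n(\theta,\psi)=(\theta+2\pi m,\psi)$. A RIC is $(m,n)$-resonant if all its points are periodic of type $(m,n)$. For the geodesic circle, $f_0(\theta,\psi)=(\theta+\alpha(\psi),\psi)$ with $\alpha:(0,\pi)\to(0,2\pi)$ depending only on $\psi$ (and $\rho_0$), and $\Upsilon_0^{\frac{m}{n}}=\{(\theta,\psi^{\frac{m}{n}}):\theta\in\mathbb{T}\}$, where $\alpha(\psi^{\frac{m}{n}})=2\pi m/n$. Persistence. An $(m,n)$-resonant smooth RIC $\Upsilon$ of $f_0$ persists under the perturbation $f_\epsilon=f_0+O(\epsilon)$ if for every small enough $\epsilon$ the map $f_\epsilon$ has an $(m,n)$-resonant RIC $\Upsilon_\epsilon$ with $\Upsilon_\epsilon=\Upsilon+O(\epsilon)$. It breaks up if it does not persist.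
   Formalization: The condition is taken as: there is a nonzero j in nZ with c_j ≠ 0; with j = 0 allowed the claim fails, since for ρ_ε = ρ_0 + ε in the Euclidean plane c_0 = 1 and every resonant circle persists. *)

(* Defs.v *)
(* Stdlib reals with Coquelicot. *)
From Stdlib Require Import Reals ZArith Znumtheory ClassicalEpsilon.
From Coquelicot Require Import Coquelicot.
Open Scope R_scope.

(** * The three model surfaces *)

Inductive surface := E2 | S2plus | H2plus.

Definition vec3 : Type := (R * R * R)%type.

Definition vx (u : vec3) : R := fst (fst u).
Definition vy (u : vec3) : R := snd (fst u).
Definition vz (u : vec3) : R := snd u.

Definition vadd (u v : vec3) : vec3 := (vx u + vx v, vy u + vy v, vz u + vz v).
Definition vscal (a : R) (u : vec3) : vec3 := (a * vx u, a * vy u, a * vz u).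
Definition cross (u v : vec3) : vec3 :=
  (vy u * vz v - vz u * vy v,
   vz u * vx v - vx u * vz v,
   vx u * vy v - vy u * vx v).
Definition det3 (u v w : vec3) : R :=
  vx (cross u v) * vx w + vy (cross u v) * vy w + vz (cross u v) * vz w.

Definition curv (M : surface) : R :=
  match M with E2 => 0 | S2plus => 1 | H2plus => -1 end.

Definition sn (M : surface) (r : R) : R :=
  match M with E2 => r | S2plus => sin r | H2plus => sinh r end.
Definition cs (M : surface) (r : R) : R :=
  match M with E2 => 1 | S2plus => cos r | H2plus => cosh r end.

Definition polar (M : surface) (r t : R) : vec3 :=
  (sn M r * cos t, sn M r * sin t, cs M r).

(* Radii of the points other than the pole. *)
Definition radius_ok (M : surface) (r : R) : Prop :=
  match M with S2plus => 0 < r < PI / 2 | _ => 0 < r end.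

(* Only applied to vectors tangent to [M], where it is the metric of [M]:
   the Euclidean metric on [S2plus], the Lorentzian one on [H2plus], and the
   Euclidean one on [E2], whose tangent vectors have zero third coordinate. *)
Definition metric (M : surface) (u v : vec3) : R :=
  vx u * vx v + vy u * vy v + curv M * (vz u * vz v).

Definition len (M : surface) (u : vec3) : R := sqrt (metric M u u).

(* [rot M p v] is the tangent vector [v] at [p] turned by +PI/2 in the tangent
   plane, oriented by the polar coordinates: it is orthogonal to [v], has the
   same length, and [det3 p v (rot M p v) = metric M v v]. *)
Definition rot (M : surface) (p v : vec3) : vec3 :=
  (vx (cross p v), vy (cross p v), curv M * vz (cross p v)).

(* The geodesic issued from [p] with unit initial velocity [v]: a straight
   line, a great circle, or a branch of hyperbola in a plane through 0. *)
Definition geodesic (M : surface) (p v : vec3) (s : R) : vec3 :=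
  vadd (vscal (cs M s) p) (vscal (sn M s) v).

Definition velocity (c : R -> vec3) (t : R) : vec3 :=
  (Derive (fun s => vx (c s)) t,
   Derive (fun s => vy (c s)) t,
   Derive (fun s => vz (c s)) t).

(** * Ovals in geodesic polar coordinates *)

Definition pcurve (M : surface) (rho : R -> R) (t : R) : vec3 :=
  polar M (rho t) t.

(* The triple product is [metric M c'' (rot M c c')]; the normal to [M] along
   [c] is [c] itself on [S2plus] and [H2plus], and [(0,0,1)] on [E2]. *)
Definition geodesic_curvature (M : surface) (c : R -> vec3) (t : R) : R :=
  det3 (c t) (velocity c t) (velocity (velocity c) t)
  / len M (velocity c t) ^ 3.

Definition oval (M : surface) (rho : R -> R) : Prop :=
  let c := pcurve M rho in
  (forall t, radius_ok M (rho t)) /\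
  (forall t, rho (t + 2 * PI) = rho t) /\
  (forall t t', c t = c t' -> exists k : Z, t' = t + 2 * PI * IZR k) /\
  (forall t, velocity c t <> (0, 0, 0)) /\
  (forall t, 0 < geodesic_curvature M c t).

Definition inside (M : surface) (rho : R -> R) (p : vec3) : Prop :=
  exists r t, 0 <= r < rho t /\ p = polar M r t.

(** * Billiard map *)

Definition tangent (M : surface) (rho : R -> R) (t : R) : vec3 :=
  vscal (/ len M (velocity (pcurve M rho) t)) (velocity (pcurve M rho) t).

(* The unit tangent vector of [M] at the impact point [t] making the angle
   [a] with the curve; it points inwards when [0 < a < PI]. *)
Definition direction (M : surface) (rho : R -> R) (t a : R) : vec3 :=
  vadd (vscal (cos a) (tangent M rho t))
       (vscal (sin a) (rot M (pcurve M rho t) (tangent M rho t))).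

(* Elastic reflection at [Gamma(t1)] reverses the normal component of the
   velocity, so an outgoing angle [a1] means an incoming one [- a1]. *)
Definition billiard_step (M : surface) (rho : R -> R) (z w : R * R) : Prop :=
  let (t0, a0) := z in
  let (t1, a1) := w in
  0 < a0 < PI /\ 0 < a1 < PI /\ 0 < t1 - t0 < 2 * PI /\
  exists l : R, 0 < l /\
    let g := geodesic M (pcurve M rho t0) (direction M rho t0 a0) in
    (forall s, 0 < s < l -> inside M rho (g s)) /\
    g l = pcurve M rho t1 /\
    velocity g l = direction M rho t1 (- a1).

(* The lift to [R * (0, PI)] of the billiard map. For an oval, every point of
   the phase space has exactly one successor; the value [z] is a dummy used
   outside the phase space, or when the curve is not an oval. *)
Definition billiard_map (M : surface) (rho : R -> R) (z : R * R) : R * R :=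
  match excluded_middle_informative (exists w, billiard_step M rho z w) with
  | left H => proj1_sig (constructive_indefinite_description _ H)
  | right _ => z
  end.

(* [alpha] in [f_0 (theta, psi) = (theta + alpha psi, psi)]. *)
Definition rotation_angle (M : surface) (rho0 psi : R) : R :=
  fst (billiard_map M (fun _ => rho0) (0, psi)).

(** * Resonant rotational invariant circles *)

(* Subsets of the cylinder [R / 2 PI Z * (0, PI)] are represented by their
   preimages in [R * (0, PI)], and maps of the cylinder by their lifts. *)
Definition cyl_eq (z w : R * R) : Prop :=
  exists k : Z, fst w = fst z + 2 * PI * IZR k /\ snd w = snd z.

(* A closed curve is the image of a loop [s |-> (x s, y s)], lifted to the
   covering; it is homotopically nontrivial iff its degree [d] is not 0. *)
Definition essential_curve (U : R * R -> Prop) : Prop :=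
  exists (x y : R -> R) (d : Z),
    d <> 0%Z /\
    (forall s, continuous x s) /\ (forall s, continuous y s) /\
    (forall s, x (s + 1) = x s + 2 * PI * IZR d) /\
    (forall s, y (s + 1) = y s) /\
    (forall s, 0 < y s < PI) /\
    (forall z, U z <-> exists s, cyl_eq (x s, y s) z).

Definition RIC (f : R * R -> R * R) (U : R * R -> Prop) : Prop :=
  essential_curve U /\
  (forall w, U w <-> exists z, U z /\ cyl_eq (f z) w).

Definition periodic_of_type (f : R * R -> R * R) (m n : nat) (z : R * R) : Prop :=
  Nat.iter n f z = (fst z + 2 * PI * INR m, snd z) /\
  (forall k : nat, (0 < k < n)%nat -> ~ cyl_eq (Nat.iter k f z) z).

Definition resonant_RIC (f : R * R -> R * R) (m n : nat) (U : R * R -> Prop) : Prop :=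
  RIC f U /\ (forall z, U z -> periodic_of_type f m n z).

Definition horizontal_circle (psi : R) (z : R * R) : Prop := snd z = psi.

(** * Persistence *)

Definition Hausdorff_le (r : R) (U V : R * R -> Prop) : Prop :=
  let near z w := Rabs (fst z - fst w) <= r /\ Rabs (snd z - snd w) <= r in
  (forall z, U z -> exists w, V w /\ near z w) /\
  (forall w, V w -> exists z, U z /\ near z w).

Definition persists (f : R -> R * R -> R * R) (m n : nat) (U : R * R -> Prop) : Prop :=
  exists e1 C : R, 0 < e1 /\ 0 < C /\
    forall e : R, Rabs e < e1 ->
      exists V : R * R -> Prop,
        resonant_RIC (f e) m n V /\ Hausdorff_le (C * Rabs e) V U.

Definition breaks_up (f : R -> R * R -> R * R) (m n : nat) (U : R * R -> Prop) : Prop :=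
  ~ persists f m n U.

(** * Fourier coefficients *)

Definition cis (t : R) : C := (cos t, sin t).

Definition fourier_coeff (g : R -> R) (j : Z) : C :=
  (RtoC (/ (2 * PI)) *
   RInt (V := C_R_CompleteNormedModule)
     (fun t => (RtoC (g t) * cis (- (IZR j * t)))%C) 0 (2 * PI))%C.

(* Main.v *)
Require Import Defs.
From Stdlib Require Import Reals ZArith Znumtheory.
From Stdlib Require Import Lra Lia ClassicalEpsilon.
From Coquelicot Require Import Coquelicot.
Open Scope R_scope.

(** The proof rests on a conservation law of Clairaut type.  A geodesic of [M]
    lies in a plane through the origin, and the vector [p x v] (position times
    unit velocity) is constant along it.  Write
    [v = A e_rho + B e_theta].  Then [p x v] has vertical coordinate
    [B sn(rho)], the Clairaut integral, and its horizontal part, read as a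
    complex number, is [(i A - B cs(rho)) exp(i theta)].  A billiard step
    therefore equates this vector for the outgoing velocity at one impact with
    the one for the incoming velocity at the next ([billiard_step_momentum]).

    The vertical coordinate gives an exact identity.  Reflection changes it by
    [2 sn(rho) sin(a) rho'(theta) / speed], where [speed] is the length of the
    velocity of the boundary curve, so along a periodic orbit these jumps add
    up to zero ([clairaut_sum]).

    The horizontal part locates the impacts.  If the circle persists, then for
    each [theta] and each small [e] there is an [(m, n)]-periodic orbit issued
    from the polar angle [theta] all of whose reflection angles are within
    [O(e)] of [psi].  As [e] tends to 0, the quotient of the horizontal parts
    tends to its value on the circle, so the [k]-th impact tends to
    [theta + k alpha] modulo [2 PI], with [alpha = 2 PI m / n]
    ([momentum_step_limit]).

    Dividing the exact identity by [e] and letting [e] tend to 0 yields the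
    vanishing of the sum of [rho1'(theta + k alpha)] over [0 <= k < n], for
    every [theta] ([persistence_orbit_sum]).  Hence the sum of
    [rho1(theta + k alpha)] does not depend on [theta].  For [j] a nonzero
    multiple of [n], the function [exp(-i j theta)] is invariant under
    translation by [alpha] and has mean zero, so the [j]-th Fourier coefficient
    of [rho1] vanishes ([fourier_coeff_eq_0]). *)

Lemma choice_nat {B : Type} (P : nat -> B -> Prop) :
  (forall i, exists b, P i b) -> exists f, forall i, P i (f i).
Proof.
  intro H. exists (fun i => proj1_sig (constructive_indefinite_description _ (H i))).
  intro i. apply proj2_sig.
Qed.

(** * The conserved vector of a geodesic *)

Lemma cs2_curv_sn2 M r : cs M r ^ 2 + curv M * sn M r ^ 2 = 1.
Proof.
  destruct M; simpl.
  - ring.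
  - generalize (sin2_cos2 r); unfold Rsqr; lra.
  - assert (H : exp r * exp (- r) = 1)
      by (rewrite <- exp_plus, Rplus_opp_r; exact exp_0).
    unfold cosh, sinh. nra.
Qed.

Lemma is_derive_sn M r : is_derive (sn M) r (cs M r).
Proof.
  apply is_derive_Reals; destruct M; simpl.
  - apply derivable_pt_lim_id.
  - apply derivable_pt_lim_sin.
  - apply derivable_pt_lim_sinh.
Qed.

Lemma is_derive_cs M r : is_derive (cs M) r (- curv M * sn M r).
Proof.
  apply is_derive_Reals; destruct M; simpl.
  - replace (- 0 * r) with 0 by ring. apply derivable_pt_lim_const.
  - replace (- (1) * sin r) with (- sin r) by ring. apply derivable_pt_lim_cos.
  - replace (- -1 * sinh r) with (sinh r) by ring. apply derivable_pt_lim_cosh.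
Qed.

Lemma radius_ok_sn_pos M r : radius_ok M r -> 0 < sn M r.
Proof.
  destruct M; simpl; intro H.
  - exact H.
  - apply sin_gt_0; lra.
  - rewrite <- sinh_0. now apply sinh_lt.
Qed.

Lemma radius_ok_cs_pos M r : radius_ok M r -> 0 < cs M r.
Proof.
  destruct M; simpl; intro H.
  - lra.
  - apply cos_gt_0; lra.
  - generalize (exp_pos r) (exp_pos (- r)); unfold cosh; lra.
Qed.

(** The length of the velocity of a curve [rho = rho(theta)] at a point where
    [rho] and its derivative take the values [r] and [r'].  The next two
    definitions are the components, on the orthonormal frame
    [(e_theta, e_rho)], of the unit vector making the angle [a] with that
    velocity. *)
Definition speed (M : surface) (r r' : R) : R := sqrt (r' ^ 2 + sn M r ^ 2).
Definition angular_part (M : surface) (r r' a : R) : R :=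
  (cos a * sn M r + sin a * r') / speed M r r'.
Definition radial_part (M : surface) (r r' a : R) : R :=
  (cos a * r' - sin a * sn M r) / speed M r r'.

(** The vector [p x v], for [p] the point of polar coordinates [(r, t)] and [v]
    the unit vector making the angle [a] with the curve: it uses
    [p x e_rho = e_theta] and
    [p x e_theta = (- cs r cos t, - cs r sin t, sn r)]. *)
Definition momentum (M : surface) (r r' t a : R) : vec3 :=
  (- radial_part M r r' a * sin t - angular_part M r r' a * cs M r * cos t,
   radial_part M r r' a * cos t - angular_part M r r' a * cs M r * sin t,
   angular_part M r r' a * sn M r).

Lemma velocity_pcurve M rho t :
  ex_derive rho t ->
  velocity (pcurve M rho) t =
    (Derive rho t * cs M (rho t) * cos t - sn M (rho t) * sin t,
     Derive rho t * cs M (rho t) * sin t + sn M (rho t) * cos t,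
     - curv M * sn M (rho t) * Derive rho t).
Proof.
  intro Hd.
  assert (Hs : is_derive (fun s => sn M (rho s)) t (Derive rho t * cs M (rho t))).
  { apply (is_derive_comp (sn M) rho t _ _ (is_derive_sn M _) (Derive_correct _ _ Hd)). }
  assert (Hc : is_derive (fun s => cs M (rho s)) t
                 (Derive rho t * (- curv M * sn M (rho t)))).
  { apply (is_derive_comp (cs M) rho t _ _ (is_derive_cs M _) (Derive_correct _ _ Hd)). }
  assert (HC : forall (F : R -> R) l, is_derive F t l ->
            Derive (fun s => F s * cos s) t = l * cos t - F t * sin t).
  { intros F l HF. apply is_derive_unique.
    auto_derive; [eexists; exact HF|].
    replace (Derive (fun x : R => F x) t) with l
      by (symmetry; exact (is_derive_unique _ _ _ HF)). ring. }
  assert (HS : forall (F : R -> R) l, is_derive F t l ->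
            Derive (fun s => F s * sin s) t = l * sin t + F t * cos t).
  { intros F l HF. apply is_derive_unique.
    auto_derive; [eexists; exact HF|].
    replace (Derive (fun x : R => F x) t) with l
      by (symmetry; exact (is_derive_unique _ _ _ HF)). ring. }
  unfold velocity, pcurve, polar, vx, vy, vz; cbn [fst snd].
  apply f_equal2; [apply f_equal2|].
  - apply (HC _ _ Hs).
  - apply (HS _ _ Hs).
  - etransitivity; [exact (is_derive_unique _ _ _ Hc)|]. ring.
Qed.

Lemma len_velocity_pcurve M rho t :
  ex_derive rho t ->
  len M (velocity (pcurve M rho) t) = speed M (rho t) (Derive rho t).
Proof.
  intro Hd. rewrite (velocity_pcurve _ _ _ Hd).
  unfold len, speed, metric, vx, vy, vz; cbn [fst snd]. f_equal.
  generalize (cs2_curv_sn2 M (rho t)) (sin2_cos2 t); unfold Rsqr.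
  generalize (cs M (rho t)) (sn M (rho t)) (Derive rho t) (sin t) (cos t).
  intros c s d u v H1 H2.
  assert (Hk : curv M * curv M * curv M = curv M) by (destruct M; simpl; ring).
  transitivity (d * d * (c ^ 2 * (u * u + v * v) + (curv M * curv M * curv M) * s ^ 2)
                + s ^ 2 * (u * u + v * v)); [ring|].
  rewrite Hk, H2, Rmult_1_r, H1. ring.
Qed.

Lemma cross_direction M rho t a :
  ex_derive rho t ->
  cross (pcurve M rho t) (direction M rho t a)
  = momentum M (rho t) (Derive rho t) t a.
Proof.
  intro Hd. unfold direction, tangent.
  rewrite (len_velocity_pcurve _ _ _ Hd), (velocity_pcurve _ _ _ Hd).
  unfold momentum, radial_part, angular_part, Rdiv.
  generalize (cs2_curv_sn2 M (rho t)) (sin2_cos2 t); unfold Rsqr.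
  unfold cross, vadd, vscal, rot, pcurve, polar, vx, vy, vz; cbn [fst snd].
  unfold cross, vx, vy, vz; cbn [fst snd].
  generalize (/ speed M (rho t) (Derive rho t)).
  assert (Hk : curv M * curv M * curv M = curv M) by (destruct M; simpl; ring).
  revert Hk.
  generalize (cs M (rho t)) (sn M (rho t)) (Derive rho t) (sin t) (cos t) (curv M).
  intros c s d u v k Hk l H1 H2.
  assert (E1 : c ^ 2 = 1 - k * s ^ 2) by lra.
  assert (E2 : v * v = 1 - u * u) by lra.
  apply f_equal2; [apply f_equal2|].
  - ring [E1 E2 Hk].
  - ring [E1 E2 Hk].
  - ring [E1 E2 Hk].
Qed.

Lemma is_derive_geodesic_coord M x y l :
  Derive (fun s => cs M s * x + sn M s * y) l
  = - curv M * sn M l * x + cs M l * y.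
Proof.
  apply is_derive_unique.
  apply (is_derive_plus (fun s => cs M s * x) (fun s => sn M s * y)).
  - apply (is_derive_scal_l (cs M) l _ x), is_derive_cs.
  - apply (is_derive_scal_l (sn M) l _ y), is_derive_sn.
Qed.

(** In the basis [(p, v)] of its plane, position and velocity on the geodesic
    form a matrix of determinant [cs^2 + curv sn^2 = 1]. *)
Lemma cross_geodesic M p v l :
  cross (geodesic M p v l) (velocity (geodesic M p v) l) = cross p v.
Proof.
  unfold velocity, geodesic, cross, vadd, vscal, vx, vy, vz; cbn [fst snd].
  rewrite !is_derive_geodesic_coord.
  assert (E : cs M l ^ 2 = 1 - curv M * sn M l ^ 2)
    by (generalize (cs2_curv_sn2 M l); lra).
  apply f_equal2; [apply f_equal2|]; ring [E].
Qed.

(** The incoming velocity at the second impact is the direction of angle [- a1]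
    there, since the reflection has turned it into the one of angle [a1]. *)
Lemma billiard_step_momentum M rho t0 a0 t1 a1 :
  ex_derive rho t0 -> ex_derive rho t1 ->
  billiard_step M rho (t0, a0) (t1, a1) ->
  momentum M (rho t0) (Derive rho t0) t0 a0
  = momentum M (rho t1) (Derive rho t1) t1 (- a1).
Proof.
  intros D0 D1 (_ & _ & _ & l & _ & _ & Ep & Ev).
  rewrite <- (cross_direction M rho t0 a0 D0), <- (cross_direction M rho t1 (- a1) D1).
  rewrite <- Ev, <- Ep. symmetry. apply cross_geodesic.
Qed.

(** The dummy value of the billiard map is the point itself. *)
Lemma billiard_map_step M rho z :
  billiard_map M rho z <> z -> billiard_step M rho z (billiard_map M rho z).
Proof.
  unfold billiard_map.
  destruct (excluded_middle_informative _) as [H|H]; [|congruence].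
  intros _. now destruct (constructive_indefinite_description _ H).
Qed.

(** On the circle the Clairaut integral is [sn(r) cos(psi)], so it determines the
    angle of reflection: the second angle is again [psi], and the rotation angle
    [alpha] is then related to [psi] by the horizontal part of the momentum. *)
Lemma circle_momentum M r psi alpha :
  radius_ok M r -> 0 < psi < PI -> alpha <> 0 ->
  rotation_angle M r psi = alpha ->
  momentum M r 0 0 psi = momentum M r 0 alpha (- psi).
Proof.
  intros Hr Hpsi Ha Hrot. unfold rotation_angle in Hrot.
  assert (Hne : billiard_map M (fun _ => r) (0, psi) <> (0, psi)).
  { intro E. rewrite E in Hrot. simpl in Hrot. lra. }
  apply billiard_map_step in Hne.
  destruct (billiard_map M (fun _ => r) (0, psi)) as [t1 a1].
  simpl in Hrot. subst t1.
  assert (Ha1 : 0 < a1 < PI) by (destruct Hne as (_ & H & _); exact H).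
  apply billiard_step_momentum in Hne; [|apply ex_derive_const..].
  rewrite !Derive_const in Hne.
  replace psi with a1 at 2; [exact Hne|].
  assert (Hs : 0 < sn M r) by now apply radius_ok_sn_pos.
  assert (Hv : 0 < speed M r 0).
  { unfold speed. apply sqrt_lt_R0. nra. }
  assert (E : angular_part M r 0 psi * sn M r = angular_part M r 0 (- a1) * sn M r)
    by (injection Hne; auto).
  apply Rmult_eq_reg_r in E; [|lra]. unfold angular_part in E.
  apply Rmult_eq_reg_r in E; [|apply Rinv_neq_0_compat; lra].
  rewrite cos_neg, !Rmult_0_r, !Rplus_0_r in E.
  apply Rmult_eq_reg_r in E; [|lra].
  destruct (Rtotal_order a1 psi) as [H|[H|H]]; [|exact H|].
  - generalize (cos_decreasing_1 a1 psi). lra.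
  - generalize (cos_decreasing_1 psi a1). lra.
Qed.

(** * Limits of the impact points *)

Lemma is_lim_seq_derivable (f : R -> R) (df : R) (u : nat -> R) (l : R) :
  is_derive f l df -> is_lim_seq u l -> is_lim_seq (fun i => f (u i)) (f l).
Proof.
  intros Hd. apply is_lim_seq_continuous, derivable_continuous_pt.
  exists df. now apply is_derive_Reals.
Qed.

Section Limits.
Variables (M : surface) (r0 psi : R) (r r' a : nat -> R).
Hypothesis Hr0 : radius_ok M r0.
Hypothesis Hr : is_lim_seq r r0.
Hypothesis Hr' : is_lim_seq r' 0.
Hypothesis Ha : is_lim_seq a psi.

Lemma is_lim_seq_sn : is_lim_seq (fun i => sn M (r i)) (sn M r0).
Proof. exact (is_lim_seq_derivable _ _ _ _ (is_derive_sn M r0) Hr). Qed.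

Lemma is_lim_seq_cs : is_lim_seq (fun i => cs M (r i)) (cs M r0).
Proof. exact (is_lim_seq_derivable _ _ _ _ (is_derive_cs M r0) Hr). Qed.

Lemma is_lim_seq_speed : is_lim_seq (fun i => speed M (r i) (r' i)) (speed M r0 0).
Proof.
  generalize (radius_ok_sn_pos _ _ Hr0); intro Hs.
  unfold speed. simpl pow.
  apply (is_lim_seq_continuous sqrt (fun i => r' i * (r' i * 1) + sn M (r i) * (sn M (r i) * 1))).
  - apply continuity_pt_sqrt. nra.
  - apply is_lim_seq_plus'; repeat apply is_lim_seq_mult';
      try apply is_lim_seq_const; auto using is_lim_seq_sn.
Qed.

Lemma is_lim_seq_cos : is_lim_seq (fun i => cos (a i)) (cos psi).
Proof. apply is_lim_seq_continuous; [apply continuity_cos | exact Ha]. Qed.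

Lemma is_lim_seq_sin : is_lim_seq (fun i => sin (a i)) (sin psi).
Proof. apply is_lim_seq_continuous; [apply continuity_sin | exact Ha]. Qed.

Lemma is_lim_seq_angular_part :
  is_lim_seq (fun i => angular_part M (r i) (r' i) (a i)) (angular_part M r0 0 psi).
Proof.
  generalize (radius_ok_sn_pos _ _ Hr0); intro Hs.
  unfold angular_part. apply is_lim_seq_div'.
  - apply is_lim_seq_plus'; apply is_lim_seq_mult';
    auto using is_lim_seq_sn, is_lim_seq_cos, is_lim_seq_sin.
  - apply is_lim_seq_speed.
  - unfold speed. apply Rgt_not_eq, sqrt_lt_R0. nra.
Qed.

Lemma is_lim_seq_radial_part :
  is_lim_seq (fun i => radial_part M (r i) (r' i) (a i)) (radial_part M r0 0 psi).
Proof.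
  generalize (radius_ok_sn_pos _ _ Hr0); intro Hs.
  unfold radial_part. apply is_lim_seq_div'.
  - apply is_lim_seq_minus'; apply is_lim_seq_mult';
    auto using is_lim_seq_sn, is_lim_seq_cos, is_lim_seq_sin.
  - apply is_lim_seq_speed.
  - unfold speed. apply Rgt_not_eq, sqrt_lt_R0. nra.
Qed.
End Limits.

Lemma angular_part2_radial_part2 M r r' a :
  radius_ok M r -> angular_part M r r' a ^ 2 + radial_part M r r' a ^ 2 = 1.
Proof.
  intro Hr. generalize (radius_ok_sn_pos _ _ Hr); intro Hs.
  assert (Hv : 0 < speed M r r') by (apply sqrt_lt_R0; nra).
  assert (Hv2 : speed M r r' ^ 2 = r' ^ 2 + sn M r ^ 2) by (apply pow2_sqrt; nra).
  unfold angular_part, radial_part.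
  transitivity ((sin a * sin a + cos a * cos a) * (r' ^ 2 + sn M r ^ 2) / speed M r r' ^ 2).
  - field. lra.
  - rewrite <- Hv2. generalize (sin2_cos2 a); unfold Rsqr; intros ->. field. lra.
Qed.

Lemma horizontal_momentum_pos M r r' a :
  radius_ok M r -> 0 < radial_part M r r' a ^ 2 + (angular_part M r r' a * cs M r) ^ 2.
Proof.
  intro Hr. generalize (angular_part2_radial_part2 M r r' a Hr) (radius_ok_cs_pos M r Hr).
  generalize (angular_part M r r' a) (radial_part M r r' a) (cs M r). intros x y c H Hc.
  destruct (Req_dec x 0) as [->|Hx].
  - nra.
  - assert (x * c <> 0) by (apply Rmult_integral_contrapositive_currified; lra).
    generalize (pow2_ge_0 y) (Rsqr_pos_lt _ H0). unfold Rsqr. nra.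
Qed.

(** The horizontal part of the momentum equation is
    [(A0 + i B0) exp(i t0) = (A1 + i B1) exp(i t1)], where [A1 + i B1] is not
    zero because [cs] is positive.  The two conclusions are the real and
    imaginary parts of its solution. *)
Lemma momentum_solve M r0 r0' t0 a0 r1 r1' t1 a1 :
  momentum M r0 r0' t0 a0 = momentum M r1 r1' t1 a1 ->
  radius_ok M r1 ->
  let A0 := radial_part M r0 r0' a0 in let B0 := angular_part M r0 r0' a0 * cs M r0 in
  let A1 := radial_part M r1 r1' a1 in let B1 := angular_part M r1 r1' a1 * cs M r1 in
  cos t1 = ((A0 * A1 + B0 * B1) * cos t0 - (A1 * B0 - A0 * B1) * sin t0)
           / (A1 ^ 2 + B1 ^ 2) /\
  sin t1 = ((A0 * A1 + B0 * B1) * sin t0 + (A1 * B0 - A0 * B1) * cos t0)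
           / (A1 ^ 2 + B1 ^ 2).
Proof.
  intros E Hr A0 B0 A1 B1.
  assert (HD : 0 < A1 ^ 2 + B1 ^ 2) by (now apply horizontal_momentum_pos).
  injection E; fold A0 A1. intros _ EY EX.
  change (A0 * cos t0 - B0 * sin t0 = A1 * cos t1 - B1 * sin t1) in EY.
  change (- A0 * sin t0 - B0 * cos t0 = - A1 * sin t1 - B1 * cos t1) in EX.
  split; (apply Rmult_eq_reg_r with (A1 ^ 2 + B1 ^ 2); [|lra]);
    unfold Rdiv; rewrite Rmult_assoc, Rinv_l, Rmult_1_r by lra.
  - transitivity (A1 * (A1 * cos t1 - B1 * sin t1) - B1 * (- A1 * sin t1 - B1 * cos t1)); [ring|].
    rewrite <- EX, <- EY. ring.
  - transitivity (- A1 * (- A1 * sin t1 - B1 * cos t1) - B1 * (A1 * cos t1 - B1 * sin t1)); [ring|].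
    rewrite <- EX, <- EY. ring.
Qed.

(** [exp(i (t1 - t0))] is a continuous function of the radii, the slopes and the
    reflection angles, and its limit is the value on the circle, which is
    [exp(i alpha)].  Polar angles are tracked only through their cosines and
    sines, that is modulo [2 PI]. *)
Lemma momentum_step_limit M rr psi alpha tau (r0 r0' t0 a0 r1 r1' t1 a1 : nat -> R) :
  radius_ok M rr -> (forall i, radius_ok M (r1 i)) ->
  momentum M rr 0 0 psi = momentum M rr 0 alpha (- psi) ->
  is_lim_seq r0 rr -> is_lim_seq r0' 0 -> is_lim_seq a0 psi ->
  is_lim_seq r1 rr -> is_lim_seq r1' 0 -> is_lim_seq a1 psi ->
  (forall i, momentum M (r0 i) (r0' i) (t0 i) (a0 i)
             = momentum M (r1 i) (r1' i) (t1 i) (- a1 i)) ->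
  is_lim_seq (fun i => cos (t0 i)) (cos tau) ->
  is_lim_seq (fun i => sin (t0 i)) (sin tau) ->
  is_lim_seq (fun i => cos (t1 i)) (cos (tau + alpha)) /\
  is_lim_seq (fun i => sin (t1 i)) (sin (tau + alpha)).
Proof.
  intros Hrr Hr1 Hcirc L1 L2 L3 L4 L5 L6 Hmom Lc Ls.
  assert (L6' : is_lim_seq (fun i => - a1 i) (- psi)) by now apply (is_lim_seq_opp a1 psi).
  assert (HA0 := is_lim_seq_radial_part _ _ _ _ _ _ Hrr L1 L2 L3).
  assert (HB0 := is_lim_seq_mult' _ _ _ _ (is_lim_seq_angular_part _ _ _ _ _ _ Hrr L1 L2 L3)
                   (is_lim_seq_cs M _ _ L1)).
  assert (HA1 := is_lim_seq_radial_part _ _ _ _ _ _ Hrr L4 L5 L6').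
  assert (HB1 := is_lim_seq_mult' _ _ _ _ (is_lim_seq_angular_part _ _ _ _ _ _ Hrr L4 L5 L6')
                   (is_lim_seq_cs M _ _ L4)).
  assert (HD := horizontal_momentum_pos M rr 0 (- psi) Hrr).
  destruct (momentum_solve _ _ _ _ _ _ _ _ _ Hcirc Hrr) as [Hca Hsa].
  rewrite cos_0, sin_0 in Hca, Hsa.
  rewrite cos_plus, sin_plus, Hca, Hsa.
  revert HA0 HB0 HA1 HB1 HD Hmom.
  generalize (radial_part M rr 0 psi) (angular_part M rr 0 psi * cs M rr)
    (radial_part M rr 0 (- psi)) (angular_part M rr 0 (- psi) * cs M rr).
  intros A0 B0 A1 B1 HA0 HB0 HA1 HB1 HD Hmom.
  assert (HN1 := is_lim_seq_plus' _ _ _ _ (is_lim_seq_mult' _ _ _ _ HA0 HA1)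
                                         (is_lim_seq_mult' _ _ _ _ HB0 HB1)).
  assert (HN2 := is_lim_seq_minus' _ _ _ _ (is_lim_seq_mult' _ _ _ _ HA1 HB0)
                                         (is_lim_seq_mult' _ _ _ _ HA0 HB1)).
  assert (HN3 := is_lim_seq_plus' _ _ _ _ (is_lim_seq_mult' _ _ _ _ HA1 HA1)
                                         (is_lim_seq_mult' _ _ _ _ HB1 HB1)).
  assert (HD' : A1 * A1 + B1 * B1 <> 0) by nra.
  split.
  - assert (H := is_lim_seq_div' _ _ _ _
      (is_lim_seq_minus' _ _ _ _ (is_lim_seq_mult' _ _ _ _ HN1 Lc)
                                 (is_lim_seq_mult' _ _ _ _ HN2 Ls)) HN3 HD').
    replace (cos tau * _ - sin tau * _) with
      (((A0 * A1 + B0 * B1) * cos tau - (A1 * B0 - A0 * B1) * sin tau)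
       / (A1 * A1 + B1 * B1)) by (field; nra).
    refine (is_lim_seq_ext _ _ _ _ H). intro i. symmetry.
    etransitivity; [apply (momentum_solve _ _ _ _ _ _ _ _ _ (Hmom i) (Hr1 i))|].
    f_equal. ring.
  - assert (H := is_lim_seq_div' _ _ _ _
      (is_lim_seq_plus' _ _ _ _ (is_lim_seq_mult' _ _ _ _ HN1 Ls)
                                (is_lim_seq_mult' _ _ _ _ HN2 Lc)) HN3 HD').
    replace (sin tau * _ + cos tau * _) with
      (((A0 * A1 + B0 * B1) * sin tau + (A1 * B0 - A0 * B1) * cos tau)
       / (A1 * A1 + B1 * B1)) by (field; nra).
    refine (is_lim_seq_ext _ _ _ _ H). intro i. symmetry.
    etransitivity; [apply (momentum_solve _ _ _ _ _ _ _ _ _ (Hmom i) (Hr1 i))|].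
    f_equal. ring.
Qed.

Lemma periodic_IZR (h : R -> R) :
  (forall t, h (t + 2 * PI) = h t) -> forall (k : Z) t, h (t + 2 * PI * IZR k) = h t.
Proof.
  intros Hp.
  assert (N : forall (k : nat) t, h (t + 2 * PI * INR k) = h t).
  { induction k as [|k IH]; intro t.
    - simpl. f_equal. ring.
    - rewrite <- (IH t), <- (Hp (t + 2 * PI * INR k)). f_equal. rewrite S_INR. ring. }
  intros k t. destruct (Z_le_gt_dec 0 k) as [Hk|Hk].
  - rewrite <- (Z2Nat.id k Hk), <- INR_IZR_INZ. apply N.
  - rewrite <- (N (Z.to_nat (- k)) (t + 2 * PI * IZR k)). f_equal.
    rewrite INR_IZR_INZ, Z2Nat.id, opp_IZR by lia. ring.
Qed.

Lemma exists_centered_representative (u : R) :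
  exists k : Z, Rabs (u + 2 * PI * IZR k) <= PI.
Proof.
  generalize PI_RGT_0; intro HPI.
  exists (up (- u / (2 * PI) - / 2))%Z.
  destruct (archimed (- u / (2 * PI) - / 2)) as [H1 H2].
  revert H1 H2. generalize (IZR (up (- u / (2 * PI) - / 2))). intros q H1 H2.
  replace u with ((u / (2 * PI)) * (2 * PI)) by (field; lra).
  replace (- u / (2 * PI)) with (- (u / (2 * PI))) in * by (field; lra).
  revert H1 H2. generalize (u / (2 * PI)). intros x H1 H2.
  apply Rabs_le. split; nra.
Qed.

(** A continuous periodic function is continuous on the circle: representatives of
    [t i - tau] chosen in [[-PI, PI]] tend to 0, since their cosines tend to 1. *)
Lemma is_lim_seq_periodic (h : R -> R) (t : nat -> R) (tau : R) :
  (forall x, h (x + 2 * PI) = h x) -> continuity_pt h tau ->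
  is_lim_seq (fun i => cos (t i)) (cos tau) ->
  is_lim_seq (fun i => sin (t i)) (sin tau) ->
  is_lim_seq (fun i => h (t i)) (h tau).
Proof.
  intros Hp Hc Lc Ls. generalize PI_RGT_0; intro HPI.
  assert (L : is_lim_seq (fun i => cos (t i - tau)) 1).
  { replace 1 with (cos tau * cos tau + sin tau * sin tau)
      by (generalize (sin2_cos2 tau); unfold Rsqr; lra).
    apply is_lim_seq_ext with (fun i => cos (t i) * cos tau + sin (t i) * sin tau).
    { intro i. symmetry. apply cos_minus. }
    apply is_lim_seq_plus'; apply is_lim_seq_mult'; auto using is_lim_seq_const. }
  apply is_lim_seq_spec. intros eps.
  destruct (Hc eps (cond_pos eps)) as (d & Hd & Hcont).
  set (d' := Rmin d PI).
  assert (Hd' : 0 < d' <= PI /\ d' <= d).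
  { unfold d'. repeat split; [apply Rmin_pos; lra|apply Rmin_r|apply Rmin_l]. }
  assert (Hcd : 0 < 1 - cos d').
  { generalize (cos_decreasing_1 0 d'). rewrite cos_0. lra. }
  apply is_lim_seq_spec in L.
  destruct (L (mkposreal _ Hcd)) as [N HN]. exists N. intros i Hi.
  specialize (HN i Hi). simpl in HN. apply Rabs_def2 in HN.
  destruct (exists_centered_representative (t i - tau)) as [k Hk].
  set (u := t i - tau + 2 * PI * IZR k) in *.
  assert (Hcu : cos d' < cos (Rabs u)).
  { replace (cos (Rabs u)) with (cos (t i - tau)); [lra|].
    transitivity (cos u).
    - symmetry. apply (periodic_IZR cos).
      intro x. rewrite cos_plus, cos_2PI, sin_2PI. ring.
    - unfold Rabs. destruct (Rcase_abs u); [symmetry; apply cos_neg|reflexivity]. }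
  assert (Hu : Rabs u < d).
  { destruct (Rlt_le_dec (Rabs u) d') as [H|H]; [lra|].
    generalize (Rabs_pos u) (cos_decr_1 d' (Rabs u)). lra. }
  rewrite <- (periodic_IZR h Hp k (t i)).
  replace (t i + 2 * PI * IZR k) with (tau + u) by (unfold u; ring).
  destruct (Req_dec u 0) as [Hu0|Hu0].
  - rewrite Hu0, Rplus_0_r, Rminus_diag, Rabs_R0. apply cond_pos.
  - apply Hcont. split; [split; [exact I | intro E; lra]|].
    simpl. unfold Rdist. now replace (tau + u - tau) with u by ring.
Qed.

(** By periodicity the angles [ts i] may be brought back into [[-PI, PI]], and [g] is
    uniformly continuous on a compact rectangle. *)
Lemma periodic_uniform_limit (g : R -> R -> R) (e0 : R) (es ts : nat -> R) :
  0 < e0 ->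
  (forall e t, Rabs e < e0 -> continuity_2d_pt g e t) ->
  (forall e t, Rabs e < e0 -> g e (t + 2 * PI) = g e t) ->
  (forall i, Rabs (es i) < e0) -> is_lim_seq es 0 ->
  is_lim_seq (fun i => g (es i) (ts i) - g 0 (ts i)) 0.
Proof.
  intros He0 Hc Hp Hes Les. generalize PI_RGT_0; intro HPI.
  apply is_lim_seq_spec. intros eps.
  destruct (uniform_continuity_2d g (- (e0 / 2)) (e0 / 2) (- PI) PI) with (eps := eps)
    as [d Hd].
  { intros x y Hx _. apply Hc. apply Rabs_def1; lra. }
  assert (Hm : 0 < Rmin d (e0 / 2)) by (apply Rmin_pos; [apply cond_pos|lra]).
  apply is_lim_seq_spec in Les. destruct (Les (mkposreal _ Hm)) as [N HN].
  exists N. intros i Hi. specialize (HN i Hi). simpl in HN.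
  rewrite Rminus_0_r in HN |- *.
  assert (H1 := Rmin_l d (e0 / 2)). assert (H2 := Rmin_r d (e0 / 2)).
  destruct (exists_centered_representative (ts i)) as [k Hk].
  rewrite <- (periodic_IZR (g (es i)) (fun t => Hp (es i) t (Hes i)) k (ts i)).
  assert (H0 : Rabs 0 < e0) by (rewrite Rabs_R0; lra).
  rewrite <- (periodic_IZR (g 0) (fun t => Hp 0 t H0) k (ts i)).
  apply Rabs_le_between in Hk.
  assert (Hb := HN). apply Rabs_def2 in Hb.
  apply Hd; try lra.
  - rewrite Rminus_0_r. lra.
  - rewrite Rminus_diag, Rabs_R0. apply cond_pos.
Qed.

(** * Fourier coefficients and sums over a rotation orbit *)

Lemma RInt_period_shift (F : R -> R) (T s : R) :
  (forall t, continuous F t) -> (forall t, F (t + T) = F t) ->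
  RInt (fun t => F (t + s)) 0 T = RInt F 0 T.
Proof.
  intros Hc Hp.
  assert (Hex : forall a b, ex_RInt F a b)
    by (intros; apply (ex_RInt_continuous (V := R_CompleteNormedModule)); auto).
  assert (Sh : forall a b v, RInt (fun t => F (t + v)) a b = RInt F (a + v) (b + v)).
  { intros a b v. generalize (RInt_comp_lin F 1 v a b (Hex _ _)).
    rewrite !Rmult_1_l. intros <-. apply RInt_ext. intros x _. symmetry.
    change (1 * F (1 * x + v) = F (x + v)). now rewrite !Rmult_1_l. }
  rewrite Sh, Rplus_0_l.
  assert (E : RInt F T (T + s) = RInt F 0 s).
  { transitivity (RInt (fun t => F (t + T)) 0 s).
    - rewrite Sh. f_equal; ring.
    - apply RInt_ext. intros; apply Hp. }
  generalize (RInt_Chasles F s T (T + s) (Hex _ _) (Hex _ _)).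
  generalize (RInt_Chasles F 0 s T (Hex _ _) (Hex _ _)).
  rewrite E. unfold plus; simpl. lra.
Qed.

Lemma continuous_sum_f_R0 (F : nat -> R -> R) (N : nat) (t : R) :
  (forall k, continuous (F k) t) -> continuous (fun x => sum_f_R0 (fun k => F k x) N) t.
Proof.
  intro H. induction N as [|N IH]; simpl; [apply H|].
  apply (continuous_plus (fun x => sum_f_R0 (fun k => F k x) N) (F (S N))); auto.
Qed.

Lemma RInt_sum_f_R0 (F : nat -> R -> R) (N : nat) (a b : R) :
  (forall k t, continuous (F k) t) ->
  RInt (fun t => sum_f_R0 (fun k => F k t) N) a b
  = sum_f_R0 (fun k => RInt (F k) a b) N.
Proof.
  intro H. induction N as [|N IH]; simpl.
  - reflexivity.
  - rewrite <- IH. apply (RInt_plus (V := R_CompleteNormedModule));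
      apply (ex_RInt_continuous (V := R_CompleteNormedModule)); intros.
    + apply continuous_sum_f_R0. auto.
    + apply H.
Qed.

Lemma is_derive_sum_f_R0 (F : nat -> R -> R) (dF : nat -> R) (N : nat) (t : R) :
  (forall k, is_derive (F k) t (dF k)) ->
  is_derive (fun x => sum_f_R0 (fun k => F k x) N) t (sum_f_R0 dF N).
Proof.
  intro H. induction N as [|N IH]; simpl; [apply H|].
  apply (is_derive_plus (fun x => sum_f_R0 (fun k => F k x) N) (F (S N))); auto.
Qed.

Lemma is_lim_seq_sum_f_R0 (u : nat -> nat -> R) (l : nat -> R) (N : nat) :
  (forall k, (k <= N)%nat -> is_lim_seq (u k) (l k)) ->
  is_lim_seq (fun i => sum_f_R0 (fun k => u k i) N) (sum_f_R0 l N).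
Proof.
  intro H. induction N as [|N IH]; simpl; [apply H; lia|].
  apply is_lim_seq_plus'; [apply IH; intros; apply H; lia | apply H; lia].
Qed.

Lemma constant_of_null_derivative (F : R -> R) :
  (forall t, is_derive F t 0) -> forall t, F t = F 0.
Proof.
  intros H t. destruct (Rtotal_order t 0) as [L|[->|L]].
  - apply (eq_is_derive F t 0); auto.
  - reflexivity.
  - symmetry. apply (eq_is_derive F 0 t); auto.
Qed.

(** The sum of the translates of [f] by multiples of [al] is a constant [c].  The
    translates of [f phi] all have the same integral over a period, and their sum
    is [c phi] because [phi] is invariant under the translations; the latter has
    integral zero. *)
Lemma RInt_mult_eq_0_of_orbit_sum (f df phi : R -> R) (al : R) (N : nat) :
  (forall t, is_derive f t (df t)) -> (forall t, f (t + 2 * PI) = f t) ->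
  (forall t, continuous phi t) -> (forall t, phi (t + 2 * PI) = phi t) ->
  (forall k t, phi (t + INR k * al) = phi t) ->
  RInt phi 0 (2 * PI) = 0 ->
  (forall t, sum_f_R0 (fun k => df (t + INR k * al)) N = 0) ->
  RInt (fun t => f t * phi t) 0 (2 * PI) = 0.
Proof.
  intros Df Pf Cphi Pphi Sphi Iphi Hsum.
  assert (Cf : forall t, continuous f t).
  { intro t. apply (ex_derive_continuous f). eexists; apply Df. }
  assert (Cst : forall t, sum_f_R0 (fun k => f (t + INR k * al)) N
                          = sum_f_R0 (fun k => f (0 + INR k * al)) N).
  { apply (constant_of_null_derivative
             (fun t => sum_f_R0 (fun k => f (t + INR k * al)) N)).
    intro t. rewrite <- (Hsum t).
    apply (is_derive_sum_f_R0 (fun k t => f (t + INR k * al))). intro k.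
    evar_last.
    - apply (is_derive_comp f (fun t => t + INR k * al)); [apply Df|].
      auto_derive; [exact I|reflexivity].
    - unfold scal; simpl; unfold mult; simpl. ring. }
  set (F := fun t => f t * phi t).
  assert (CF : forall t, continuous F t)
    by (intro; apply (continuous_mult f phi); auto).
  assert (E : sum_f_R0 (fun k => RInt (fun t => F (t + INR k * al)) 0 (2 * PI)) N
              = sum_f_R0 (fun _ => RInt F 0 (2 * PI)) N).
  { apply sum_eq. intros k _. apply RInt_period_shift; [exact CF|].
    intro t. unfold F. now rewrite Pf, Pphi. }
  rewrite <- RInt_sum_f_R0 in E.
  2:{ intros k t. apply (continuous_comp (fun t => t + INR k * al) F); [|apply CF].
      apply (ex_derive_continuous (fun t => t + INR k * al)). auto_derive. exact I. }
  rewrite sum_cte in E.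
  assert (E0 : RInt (fun t => sum_f_R0 (fun k => F (t + INR k * al)) N) 0 (2 * PI) = 0).
  { transitivity (RInt (fun t => scal (sum_f_R0 (fun k => f (0 + INR k * al)) N) (phi t))
                    0 (2 * PI)).
    - apply RInt_ext. intros t _. rewrite <- (Cst t).
      unfold scal; simpl; unfold mult; simpl.
      rewrite Rmult_comm, scal_sum. apply sum_eq. intros k _.
      unfold F. rewrite Sphi. ring.
    - etransitivity.
      { apply (RInt_scal (V := R_CompleteNormedModule) phi).
        apply (ex_RInt_continuous (V := R_CompleteNormedModule)); auto. }
      rewrite Iphi. apply Rmult_0_r. }
  rewrite E0 in E. symmetry in E. apply Rmult_integral in E as [E|E]; [exact E|].
  exfalso. now apply (not_0_INR (S N)).
Qed.

Lemma sin_2PI_IZR (k : Z) : sin (2 * PI * IZR k) = 0.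
Proof.
  rewrite <- (Rplus_0_l (2 * PI * IZR k)), (periodic_IZR sin), sin_0; [reflexivity|].
  intro x. rewrite sin_plus, cos_2PI, sin_2PI. ring.
Qed.

Lemma cos_2PI_IZR (k : Z) : cos (2 * PI * IZR k) = 1.
Proof.
  rewrite <- (Rplus_0_l (2 * PI * IZR k)), (periodic_IZR cos), cos_0; [reflexivity|].
  intro x. rewrite cos_plus, cos_2PI, sin_2PI. ring.
Qed.

Lemma cos_plus_2PI_IZR x (k : Z) : cos (x + 2 * PI * IZR k) = cos x.
Proof. rewrite cos_plus, sin_2PI_IZR, cos_2PI_IZR. ring. Qed.

Lemma sin_plus_2PI_IZR x (k : Z) : sin (x + 2 * PI * IZR k) = sin x.
Proof. rewrite sin_plus, sin_2PI_IZR, cos_2PI_IZR. ring. Qed.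

Lemma RInt_cos_freq (j : Z) : j <> 0%Z -> RInt (fun t => cos (- (IZR j * t))) 0 (2 * PI) = 0.
Proof.
  intro Hj. apply not_0_IZR in Hj. apply is_RInt_unique.
  evar_last.
  - apply (is_RInt_derive (fun t => sin (IZR j * t) / IZR j)).
    + intros x _. auto_derive; [exact I|]. rewrite cos_neg. field. exact Hj.
    + intros x _. apply (ex_derive_continuous (fun t => cos (- (IZR j * t)))).
      auto_derive. exact I.
  - rewrite Rmult_0_r, sin_0. replace (IZR j * (2 * PI)) with (2 * PI * IZR j) by ring.
    rewrite sin_2PI_IZR. unfold minus, plus, opp; simpl. field. exact Hj.
Qed.

Lemma RInt_sin_freq (j : Z) : j <> 0%Z -> RInt (fun t => sin (- (IZR j * t))) 0 (2 * PI) = 0.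
Proof.
  intro Hj. apply not_0_IZR in Hj. apply is_RInt_unique.
  evar_last.
  - apply (is_RInt_derive (fun t => cos (IZR j * t) / IZR j)).
    + intros x _. auto_derive; [exact I|]. rewrite sin_neg. field. exact Hj.
    + intros x _. apply (ex_derive_continuous (fun t => sin (- (IZR j * t)))).
      auto_derive. exact I.
  - rewrite Rmult_0_r, cos_0. replace (IZR j * (2 * PI)) with (2 * PI * IZR j) by ring.
    rewrite cos_2PI_IZR. unfold minus, plus, opp; simpl. field. exact Hj.
Qed.

(** Writing [j = n q], the translation by [2 PI m / n] adds the integer multiple
    [2 PI q m] to the phase [j t]. *)
Lemma fourier_coeff_eq_0 (f df : R -> R) (m n : nat) (j : Z) :
  (0 < n)%nat -> (Z.of_nat n | j)%Z -> j <> 0%Z ->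
  (forall t, is_derive f t (df t)) -> (forall t, f (t + 2 * PI) = f t) ->
  (forall t, sum_f_R0 (fun k => df (t + INR k * (2 * PI * INR m / INR n))) (pred n) = 0) ->
  fourier_coeff f j = RtoC 0.
Proof.
  intros Hn [q Hq] Hj Df Pf Hsum. unfold fourier_coeff.
  assert (Hn' : INR n <> 0) by (apply not_0_INR; lia).
  assert (A1 : forall t, - (IZR j * (t + 2 * PI)) = - (IZR j * t) + 2 * PI * IZR (- j)).
  { intro t. rewrite opp_IZR. ring. }
  assert (A2 : forall k t, - (IZR j * (t + INR k * (2 * PI * INR m / INR n)))
               = - (IZR j * t) + 2 * PI * IZR (- (q * Z.of_nat k * Z.of_nat m))).
  { intros k t. rewrite opp_IZR, !mult_IZR, <- !INR_IZR_INZ.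
    rewrite Hq, mult_IZR, <- INR_IZR_INZ. field. exact Hn'. }
  assert (Cf : forall t, continuous f t).
  { intro t. apply (ex_derive_continuous f). eexists; apply Df. }
  assert (Ccos : forall t, continuous (fun t => cos (- (IZR j * t))) t).
  { intro t. apply (ex_derive_continuous (fun t => cos (- (IZR j * t)))). auto_derive. exact I. }
  assert (Csin : forall t, continuous (fun t => sin (- (IZR j * t))) t).
  { intro t. apply (ex_derive_continuous (fun t => sin (- (IZR j * t)))). auto_derive. exact I. }
  assert (Ic : RInt (fun t => f t * cos (- (IZR j * t))) 0 (2 * PI) = 0).
  { apply (RInt_mult_eq_0_of_orbit_sum f df (fun t => cos (- (IZR j * t)))
             (2 * PI * INR m / INR n) (pred n)); auto.
    - intro t. now rewrite A1, cos_plus_2PI_IZR.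
    - intros k t. now rewrite A2, cos_plus_2PI_IZR.
    - now apply RInt_cos_freq. }
  assert (Is : RInt (fun t => f t * sin (- (IZR j * t))) 0 (2 * PI) = 0).
  { apply (RInt_mult_eq_0_of_orbit_sum f df (fun t => sin (- (IZR j * t)))
             (2 * PI * INR m / INR n) (pred n)); auto.
    - intro t. now rewrite A1, sin_plus_2PI_IZR.
    - intros k t. now rewrite A2, sin_plus_2PI_IZR.
    - now apply RInt_sin_freq. }
  assert (E : is_RInt (V := C_R_NormedModule)
     (fun t => (RtoC (f t) * cis (- (IZR j * t)))%C) 0 (2 * PI) (RtoC 0)).
  { apply (is_RInt_fct_extend_pair (U := R_NormedModule) (V := R_NormedModule)); simpl.
    - evar_last; [|exact Ic].
      apply is_RInt_ext with (fun t => f t * cos (- (IZR j * t))).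
      + intros x _. match goal with |- ?a = ?b => change (@eq R a b) end. ring.
      + apply (RInt_correct (V := R_CompleteNormedModule)).
        apply (ex_RInt_continuous (V := R_CompleteNormedModule)). intros.
        apply (continuous_mult f (fun t => cos (- (IZR j * t)))); auto.
    - evar_last; [|exact Is].
      apply is_RInt_ext with (fun t => f t * sin (- (IZR j * t))).
      + intros x _. match goal with |- ?a = ?b => change (@eq R a b) end. ring.
      + apply (RInt_correct (V := R_CompleteNormedModule)).
        apply (ex_RInt_continuous (V := R_CompleteNormedModule)). intros.
        apply (continuous_mult f (fun t => sin (- (IZR j * t)))); auto. }
  rewrite (is_RInt_unique (V := C_R_CompleteNormedModule) _ _ _ _ E). apply Cmult_0_r.
Qed.

(** * The family of curves near the circle *)

Definition slope (rho : R -> R -> R) (e t : R) : R := Derive (fun s => rho e s) t.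

(** For [e = 0] the mixed derivative is the derivative of [rho1]
    ([is_derive_rho1]); this order of differentiation suits the mean value theorem
    in [e], applied to the slope. *)
Definition mixed_derivative (rho : R -> R -> R) (e t : R) : R :=
  Derive (fun u => slope rho u t) e.

Section Family.
Variables (e0 rho0 : R) (rho : R -> R -> R) (rho1 : R -> R).
Hypothesis he0 : 0 < e0.
Hypothesis hsmooth : forall (k : nat) (e t : R), Rabs e < e0 -> ex_diff_n rho k e t.
Hypothesis hperiodic : forall e t : R, Rabs e < e0 -> rho e (t + 2 * PI) = rho e t.
Hypothesis hexpansion : exists K d : R, 0 < d /\
     forall e t : R, Rabs e < d ->
       Rabs (rho e t - (rho0 + e * rho1 t)) <= K * e ^ 2.

Lemma small_0 : Rabs 0 < e0.
Proof. now rewrite Rabs_R0. Qed.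

Lemma family_regularity e t : Rabs e < e0 ->
  continuity_2d_pt rho e t /\ ex_derive (fun u => rho u t) e /\
  ex_derive (fun s => rho e s) t /\
  continuity_2d_pt (slope rho) e t /\ ex_derive (fun u => slope rho u t) e /\
  ex_derive (fun s => Derive (fun u => rho u s) e) t /\
  continuity_2d_pt (mixed_derivative rho) e t /\
  continuity_2d_pt (fun u s => Derive (fun s => Derive (fun u => rho u s) u) s) e t.
Proof.
  intro He. generalize (hsmooth 2 e t He). simpl. unfold mixed_derivative, slope. tauto.
Qed.

Lemma ex_derive_slope e t : Rabs e < e0 -> ex_derive (fun u => slope rho u t) e.
Proof. intro He. now destruct (family_regularity e t He) as (_ & _ & _ & _ & H & _). Qed.

Lemma continuity_mixed_derivative e t :
  Rabs e < e0 -> continuity_2d_pt (mixed_derivative rho) e t.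
Proof. intro He. now destruct (family_regularity e t He) as (_ & _ & _ & _ & _ & _ & H & _). Qed.

Lemma rho_0 t : rho 0 t = rho0.
Proof.
  destruct hexpansion as (K & d & Hd & H).
  specialize (H 0 t). rewrite Rabs_R0 in H. specialize (H Hd).
  replace (K * 0 ^ 2) with 0 in H by ring.
  replace (rho0 + 0 * rho1 t) with rho0 in H by ring.
  generalize (Rabs_pos (rho 0 t - rho0)); intro Hp.
  assert (E : Rabs (rho 0 t - rho0) = 0) by lra.
  apply Rabs_eq_0 in E. lra.
Qed.

Lemma slope_0 t : slope rho 0 t = 0.
Proof.
  unfold slope. rewrite (Derive_ext _ (fun _ => rho0)); [apply Derive_const|].
  intro; apply rho_0.
Qed.

Lemma slope_periodic e t : Rabs e < e0 -> slope rho e (t + 2 * PI) = slope rho e t.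
Proof.
  intro He. unfold slope.
  rewrite <- (Derive_ext (fun s => rho e (s + 2 * PI)) (fun s => rho e s) t)
    by (intro; now apply hperiodic).
  symmetry. rewrite (Derive_comp (fun s => rho e s) (fun s => s + 2 * PI)).
  - replace (Derive (fun s => s + 2 * PI) t) with 1; [ring|].
    symmetry. apply is_derive_unique. auto_derive; [exact I|reflexivity].
  - exact (proj1 (proj2 (proj2 (family_regularity e _ He)))).
  - auto_derive. exact I.
Qed.

Lemma locally_small e : Rabs e < e0 -> locally e (fun u => Rabs u < e0).
Proof.
  intro He. apply (open_comp Rabs (fun y => y < e0)).
  - intros x _. apply continuous_Rabs.
  - apply open_lt.
  - exact He.
Qed.

Lemma mixed_derivative_periodic e t :
  Rabs e < e0 -> mixed_derivative rho e (t + 2 * PI) = mixed_derivative rho e t.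
Proof.
  intro He. unfold mixed_derivative. apply Derive_ext_loc.
  generalize (locally_small e He). apply filter_imp.
  intros u Hu. now apply slope_periodic.
Qed.

(** The circle has zero slope, so the slope of a nearby curve is of order [e]. *)
Lemma slope_mean_value e t : Rabs e < e0 ->
  exists x, Rabs x <= Rabs e /\ slope rho e t = e * mixed_derivative rho x t.
Proof.
  intro He.
  assert (Hs : forall x, Rmin 0 e <= x <= Rmax 0 e -> Rabs x <= Rabs e).
  { intros x. unfold Rmin, Rmax. destruct (Rle_dec 0 e); intro Hx;
    unfold Rabs; destruct (Rcase_abs x), (Rcase_abs e); lra. }
  destruct (MVT_gen (fun u => slope rho u t) 0 e (fun u => mixed_derivative rho u t))
    as (x & Hx & E).
  - intros x Hx. apply Derive_correct, ex_derive_slope.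
    generalize (Hs x). lra.
  - intros x Hx. apply continuity_pt_filterlim.
    apply (ex_derive_continuous (fun u => slope rho u t)), ex_derive_slope.
    generalize (Hs x Hx). lra.
  - exists x. split; [now apply Hs|]. rewrite slope_0 in E. lra.
Qed.

Lemma is_derive_rho_e t : is_derive (fun e => rho e t) 0 (rho1 t).
Proof.
  destruct hexpansion as (K & d & Hd & H).
  apply is_derive_Reals. intros eps Heps.
  assert (HK : 0 < Rabs K + 1) by (generalize (Rabs_pos K); lra).
  assert (Hm : 0 < Rmin d (eps / (Rabs K + 1))).
  { apply Rmin_pos; [lra|]. now apply Rdiv_lt_0_compat. }
  exists (mkposreal _ Hm). intros h Hh0 Hh. simpl in Hh.
  assert (H1 := Rmin_l d (eps / (Rabs K + 1))).
  assert (H2 := Rmin_r d (eps / (Rabs K + 1))).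
  assert (Hhd : Rabs h < d) by lra. specialize (H h t Hhd).
  rewrite Rplus_0_l, rho_0.
  replace ((rho h t - rho0) / h - rho1 t) with ((rho h t - (rho0 + h * rho1 t)) / h)
    by (field; exact Hh0).
  unfold Rdiv. rewrite Rabs_mult, Rabs_inv.
  assert (Hph : 0 < Rabs h) by now apply Rabs_pos_lt.
  apply Rmult_lt_reg_r with (Rabs h); [exact Hph|].
  rewrite Rmult_assoc, Rinv_l, Rmult_1_r by lra.
  apply Rle_lt_trans with (1 := H).
  rewrite <- (pow2_abs h).
  assert (H3 : Rabs h * (Rabs K + 1) < eps).
  { replace eps with (eps / (Rabs K + 1) * (Rabs K + 1)) by (field; lra).
    apply Rmult_lt_compat_r; lra. }
  generalize (Rle_abs K). intro HK'.
  simpl. rewrite Rmult_1_r, <- Rmult_assoc.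
  apply Rmult_lt_compat_r; [exact Hph|]. nra.
Qed.

Lemma rho1_periodic t : rho1 (t + 2 * PI) = rho1 t.
Proof.
  rewrite <- (is_derive_unique _ _ _ (is_derive_rho_e t)).
  rewrite <- (is_derive_unique _ _ _ (is_derive_rho_e (t + 2 * PI))).
  apply Derive_ext_loc. generalize (locally_small 0 small_0). apply filter_imp.
  intros u Hu. now apply hperiodic.
Qed.

(** The function [rho1] is the derivative of [rho] in [e] at 0; Schwarz's theorem
    exchanges the two derivatives. *)
Lemma is_derive_rho1 t : is_derive rho1 t (mixed_derivative rho 0 t).
Proof.
  destruct (family_regularity 0 t small_0) as (_ & _ & _ & _ & _ & Hd & Hc & Hc').
  apply is_derive_ext with (fun s => Derive (fun u => rho u s) 0).
  { intro s. exact (is_derive_unique _ _ _ (is_derive_rho_e s)). }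
  unfold mixed_derivative, slope.
  rewrite (Schwarz rho 0 t); [now apply Derive_correct| |exact Hc|exact Hc'].
  exists (mkposreal _ he0). intros u v Hu _. simpl in Hu. rewrite Rminus_0_r in Hu.
  destruct (family_regularity u v Hu) as (_ & H1 & H2 & _ & H3 & H4 & _).
  repeat split; assumption.
Qed.

(** The quotient is the mixed derivative at an intermediate parameter, which tends to
    0.  Only the limit of [ts] modulo [2 PI] matters, by periodicity. *)
Lemma is_lim_seq_slope_quotient (es ts : nat -> R) (tau : R) :
  (forall i, 0 < Rabs (es i) < e0) -> is_lim_seq es 0 ->
  is_lim_seq (fun i => cos (ts i)) (cos tau) ->
  is_lim_seq (fun i => sin (ts i)) (sin tau) ->
  is_lim_seq (fun i => slope rho (es i) (ts i) / es i) (mixed_derivative rho 0 tau).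
Proof.
  intros Hes Les Lc Ls.
  destruct (choice_nat (fun i x => Rabs x <= Rabs (es i) /\
              slope rho (es i) (ts i) = es i * mixed_derivative rho x (ts i))) as [xs Hxs].
  { intro i. apply slope_mean_value, Hes. }
  assert (Lx : is_lim_seq xs 0).
  { apply is_lim_seq_abs_0. apply is_lim_seq_le_le with (fun _ => 0) (fun i => Rabs (es i)).
    - intro i. split; [apply Rabs_pos|apply Hxs].
    - apply is_lim_seq_const.
    - now apply is_lim_seq_abs_0 in Les. }
  assert (L1 : is_lim_seq
    (fun i => mixed_derivative rho (xs i) (ts i) - mixed_derivative rho 0 (ts i)) 0).
  { apply (periodic_uniform_limit (mixed_derivative rho) e0); auto.
    - exact continuity_mixed_derivative.
    - intros e t He. now apply mixed_derivative_periodic.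
    - intro i. generalize (Hes i) (proj1 (Hxs i)). lra. }
  assert (L2 : is_lim_seq (fun i => mixed_derivative rho 0 (ts i)) (mixed_derivative rho 0 tau)).
  { apply is_lim_seq_periodic; auto.
    - intro t. apply mixed_derivative_periodic, small_0.
    - assert (Hc := continuity_mixed_derivative 0 tau small_0).
      intros eps Heps. destruct (Hc (mkposreal _ Heps)) as [dl Hdl].
      exists dl. split; [apply cond_pos|]. intros y [_ Hy]. apply Hdl; [|exact Hy].
      rewrite Rminus_diag, Rabs_R0. apply cond_pos. }
  apply is_lim_seq_ext with (fun i =>
      (mixed_derivative rho (xs i) (ts i) - mixed_derivative rho 0 (ts i))
      + mixed_derivative rho 0 (ts i)).
  { intro i. rewrite (proj2 (Hxs i)). field.
    intro E. generalize (Hes i). rewrite E, Rabs_R0. lra. }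
  rewrite <- (Rplus_0_l (mixed_derivative rho 0 tau)). now apply is_lim_seq_plus'.
Qed.
End Family.

(** * Orbits on a resonant circle *)

(** The intermediate value theorem applies to the lifted angle [x]: over one unit
    of the parameter it moves by [2 PI d], hence by at least a full turn. *)
Lemma essential_curve_over (U : R * R -> Prop) :
  essential_curve U -> forall theta, exists a, 0 < a < PI /\ U (theta, a).
Proof.
  intros (x & y & d & Hd & Cx & Cy & Px & Py & Ry & HU) theta.
  generalize PI_RGT_0; intro HPI.
  assert (Hs : exists s k, x s = theta + 2 * PI * IZR k).
  { (* the representative of theta within PI of the middle of the first full turn *)
    destruct (exists_centered_representative (theta - x 0 - IZR (Z.sgn d) * PI)) as [k Hk].
    apply Rabs_le_between in Hk.
    assert (Hx1 : x 1 = x 0 + 2 * PI * IZR d) by (rewrite <- (Px 0); f_equal; ring).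
    destruct (IVT_gen x 0 1 (theta + 2 * PI * IZR k)) as (s & _ & Hs).
    - intro s. apply continuity_pt_filterlim, Cx.
    - rewrite Hx1. destruct (Z_lt_le_dec 0 d) as [H|H].
      + rewrite Z.sgn_pos in Hk by lia.
        assert (1 <= IZR d) by (apply IZR_le; lia).
        rewrite Rmin_left, Rmax_right by nra. nra.
      + rewrite Z.sgn_neg in Hk by lia.
        assert (IZR d <= -1) by (apply IZR_le; lia).
        rewrite Rmin_right, Rmax_left by nra. nra.
    - now exists s, k. }
  destruct Hs as (s & k & Hs).
  exists (y s). split; [apply Ry|]. apply HU. exists s.
  exists (- k)%Z. simpl. rewrite Hs, opp_IZR. split; [ring|reflexivity].
Qed.

(** The period being at least 2, the billiard map fixes no point of the circle, so
    that it does not take its dummy value there. *)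
Lemma resonant_RIC_step M rho m n U z :
  (2 <= n)%nat -> resonant_RIC (billiard_map M rho) m n U -> U z ->
  U (billiard_map M rho z) /\ billiard_step M rho z (billiard_map M rho z).
Proof.
  intros Hn [[_ Hinv] Hper] Hz.
  assert (Hrefl : forall w, cyl_eq w w)
    by (intro w; exists 0%Z; split; [ring|reflexivity]).
  split.
  - apply Hinv. now exists z.
  - apply billiard_map_step. intro E.
    destruct (Hper z Hz) as [_ H]. apply (H 1%nat); [lia|]. simpl. rewrite E. apply Hrefl.
Qed.

Lemma resonant_RIC_iter M rho m n U z k :
  (2 <= n)%nat -> resonant_RIC (billiard_map M rho) m n U -> U z ->
  U (Nat.iter k (billiard_map M rho) z).
Proof.
  intros Hn HU Hz. induction k as [|k IH]; [exact Hz|].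
  simpl. now apply (resonant_RIC_step _ _ _ _ _ _ Hn HU).
Qed.

Lemma sum_telescope_cyclic (u v : nat -> R) (N : nat) :
  (forall k, (k <= N)%nat -> u k = v (S k)) -> v (S N) = v 0%nat ->
  sum_f_R0 (fun k => u k - v k) N = 0.
Proof.
  intros H E.
  assert (G : forall K, (K <= N)%nat -> sum_f_R0 (fun k => u k - v k) K = v (S K) - v 0%nat).
  { induction K as [|K IH]; intro HK; simpl.
    - rewrite H by lia. reflexivity.
    - rewrite IH, (H (S K)) by lia. ring. }
  rewrite G by lia. lra.
Qed.

(** The summand is the jump of the Clairaut integral at the [k]-th reflection.
    Between reflections the integral is conserved, so over a period the jumps
    telescope. *)
Lemma clairaut_sum M (rho : R -> R) (t a : nat -> R) (m n : nat) :
  (0 < n)%nat ->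
  (forall s, ex_derive rho s) -> (forall s, rho (s + 2 * PI) = rho s) ->
  (forall s, Derive rho (s + 2 * PI) = Derive rho s) ->
  (forall k, billiard_step M rho (t k, a k) (t (S k), a (S k))) ->
  t n = t 0%nat + 2 * PI * INR m -> a n = a 0%nat ->
  sum_f_R0 (fun k => 2 * sn M (rho (t k)) * sin (a k) * Derive rho (t k)
                     / speed M (rho (t k)) (Derive rho (t k))) (pred n) = 0.
Proof.
  intros Hn Hd Hp Hp' Hstep Ht Ha.
  set (J := fun k b => angular_part M (rho (t k)) (Derive rho (t k)) b * sn M (rho (t k))).
  transitivity (sum_f_R0 (fun k => J k (a k) - J k (- a k)) (pred n)).
  - apply sum_eq. intros k _. unfold J, angular_part. rewrite cos_neg, sin_neg.
    unfold Rdiv. ring.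
  - apply (sum_telescope_cyclic (fun k => J k (a k)) (fun k => J k (- a k))).
    + intros k _. generalize (billiard_step_momentum _ _ _ _ _ _ (Hd _) (Hd _) (Hstep k)).
      intro E. injection E. auto.
    + rewrite Nat.succ_pred by lia. unfold J.
      rewrite Ht, Ha, INR_IZR_INZ.
      now rewrite (periodic_IZR _ Hp), (periodic_IZR _ Hp').
Qed.

(** * The orbit sum *)

(** Through every polar angle passes a point of each persisting circle.  The orbits
    of these points, for a sequence of parameters tending to 0, converge to the
    orbit of the rotation by [alpha] on the unperturbed circle, and the exact
    identity [clairaut_sum] divided by [e] passes to the limit. *)
Lemma persistence_orbit_sum (M : surface) (rho0 : R) (hrho0 : radius_ok M rho0)
  (e0 : R) (he0 : 0 < e0)
  (rho : R -> R -> R) (rho1 : R -> R)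
  (hsmooth : forall (k : nat) (e t : R), Rabs e < e0 -> ex_diff_n rho k e t)
  (hperiodic : forall e t : R, Rabs e < e0 -> rho e (t + 2 * PI) = rho e t)
  (hradius : forall e t : R, Rabs e < e0 -> radius_ok M (rho e t))
  (hexpansion : exists K d : R, 0 < d /\
     forall e t : R, Rabs e < d ->
       Rabs (rho e t - (rho0 + e * rho1 t)) <= K * e ^ 2)
  (m n : nat) (hn : (2 <= n)%nat)
  (psi : R) (hpsi : 0 < psi < PI)
  (alpha : R) (Halpha : alpha <> 0) (halpha : rotation_angle M rho0 psi = alpha) :
  persists (fun e => billiard_map M (rho e)) m n (horizontal_circle psi) ->
  forall theta,
    sum_f_R0 (fun k => mixed_derivative rho 0 (theta + INR k * alpha)) (pred n) = 0.
Proof.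
  intros (e1 & C & He1 & HC & Hpers) theta.
  assert (Hcirc := circle_momentum M rho0 psi alpha hrho0 hpsi Halpha halpha).
  assert (Hmin : 0 < Rmin e0 e1) by now apply Rmin_pos.
  (* the 2 keeps the factor below 1 already for i = 0 *)
  set (es := fun i : nat => Rmin e0 e1 * / (INR i + 2)).
  assert (Hes : forall i, 0 < Rabs (es i) < Rmin e0 e1).
  { intro i. unfold es. generalize (pos_INR i); intro Hi.
    assert (0 < / (INR i + 2)) by (apply Rinv_0_lt_compat; lra).
    assert (/ (INR i + 2) < 1) by (rewrite <- Rinv_1; apply Rinv_lt_contravar; lra).
    rewrite Rabs_pos_eq by nra. nra. }
  assert (Hes0 : forall i, 0 < Rabs (es i) < e0).
  { intro i. generalize (Hes i) (Rmin_l e0 e1). lra. }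
  assert (Les : is_lim_seq es 0).
  { unfold es. rewrite <- (Rmult_0_r (Rmin e0 e1)).
    apply is_lim_seq_mult'; [apply is_lim_seq_const|].
    apply (is_lim_seq_inv _ p_infty); [|discriminate].
    apply (is_lim_seq_plus INR (fun _ => 2) p_infty 2 p_infty);
      [apply is_lim_seq_INR|apply is_lim_seq_const|reflexivity]. }
  (* a starting point over theta on the invariant circle of each parameter es i *)
  assert (Horb : forall i, exists z, fst z = theta /\
            exists V, resonant_RIC (billiard_map M (rho (es i))) m n V /\ V z /\
              forall w, V w -> Rabs (snd w - psi) <= C * Rabs (es i)).
  { intro i. destruct (Hpers (es i)) as (V & HV & Hnear & _).
    { generalize (Hes i) (Rmin_r e0 e1). lra. }
    destruct (essential_curve_over V (proj1 (proj1 HV)) theta) as (a & _ & Hz).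
    exists (theta, a). split; [reflexivity|]. exists V. split; [exact HV|split; [exact Hz|]].
    intros w Hw. destruct (Hnear w Hw) as (w' & Hw' & _ & H).
    unfold horizontal_circle in Hw'. now rewrite Hw' in H. }
  apply choice_nat in Horb. destruct Horb as [z Hz].
  set (t := fun (k i : nat) => fst (Nat.iter k (billiard_map M (rho (es i))) (z i))).
  set (a := fun (k i : nat) => snd (Nat.iter k (billiard_map M (rho (es i))) (z i))).
  assert (Hstep : forall i k, billiard_step M (rho (es i)) (t k i, a k i) (t (S k) i, a (S k) i)).
  { intros i k. destruct (Hz i) as (_ & V & HV & HVz & _).
    unfold t, a. rewrite <- !surjective_pairing.
    apply (resonant_RIC_step _ _ _ _ _ _ hn HV), (resonant_RIC_iter _ _ _ _ _ _ _ hn HV HVz). }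
  assert (La : forall k, is_lim_seq (a k) psi).
  { intro k. apply is_lim_seq_ext with (fun i => (a k i - psi) + psi); [intro; ring|].
    replace (Finite psi) with (Finite (0 + psi)) by (f_equal; ring).
    apply is_lim_seq_plus'; [|apply is_lim_seq_const].
    apply is_lim_seq_abs_0.
    apply is_lim_seq_le_le with (fun _ => 0) (fun i => C * Rabs (es i)).
    - intro i. split; [apply Rabs_pos|].
      destruct (Hz i) as (_ & V & HV & HVz & Hb).
      apply Hb, (resonant_RIC_iter _ _ _ _ _ _ _ hn HV HVz).
    - apply is_lim_seq_const.
    - rewrite <- (Rmult_0_r C). apply is_lim_seq_mult'; [apply is_lim_seq_const|].
      now apply is_lim_seq_abs_0 in Les. }
  set (r := fun k i => rho (es i) (t k i)).
  set (r' := fun k i => slope rho (es i) (t k i)).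
  assert (Lr : forall k, is_lim_seq (r k) rho0).
  { intro k. apply is_lim_seq_ext with (fun i => (rho (es i) (t k i) - rho 0 (t k i)) + rho0).
    { intro i. unfold r. rewrite (rho_0 rho0 rho rho1 hexpansion). ring. }
    replace (Finite rho0) with (Finite (0 + rho0)) by (f_equal; ring).
    apply is_lim_seq_plus'; [|apply is_lim_seq_const].
    apply (periodic_uniform_limit rho e0); auto; [|apply Hes0].
    intros e s He. now destruct (family_regularity e0 rho hsmooth e s He). }
  assert (Lr' : forall k, is_lim_seq (r' k) 0).
  { intro k. apply is_lim_seq_ext with (fun i => slope rho (es i) (t k i) - slope rho 0 (t k i)).
    { intro i. unfold r'. rewrite (slope_0 rho0 rho rho1 hexpansion (t k i)). ring. }
    apply (periodic_uniform_limit (slope rho) e0); auto; [| |apply Hes0].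
    - intros e s He. now destruct (family_regularity e0 rho hsmooth e s He) as (_ & _ & _ & H & _).
    - exact (slope_periodic e0 rho hsmooth hperiodic). }
  assert (Hd : forall i s, ex_derive (rho (es i)) s).
  { intros i s. destruct (family_regularity e0 rho hsmooth (es i) s (proj2 (Hes0 i)))
      as (_ & _ & H & _). exact H. }
  assert (Lt : forall k, is_lim_seq (fun i => cos (t k i)) (cos (theta + INR k * alpha)) /\
                         is_lim_seq (fun i => sin (t k i)) (sin (theta + INR k * alpha))).
  { induction k as [|k [IHc IHs]].
    - simpl INR. rewrite Rmult_0_l, Rplus_0_r.
      split; (eapply is_lim_seq_ext; [|apply is_lim_seq_const]);
        intro i; unfold t; simpl; now rewrite (proj1 (Hz i)).
    - rewrite S_INR.
      replace (theta + (INR k + 1) * alpha) with (theta + INR k * alpha + alpha) by ring.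
      apply (momentum_step_limit M rho0 psi alpha _ (r k) (r' k) (t k) (a k)
               (r (S k)) (r' (S k)) (t (S k)) (a (S k))); auto.
      + intro i. apply hradius, Hes0.
      + intro i. apply billiard_step_momentum; auto. }
  assert (Hsum : forall i, sum_f_R0 (fun k => 2 * sn M (r k i) * sin (a k i) * (r' k i / es i)
                     / speed M (r k i) (r' k i)) (pred n) = 0).
  { intro i. destruct (Hz i) as (_ & V & HV & HVz & _).
    destruct (proj2 HV _ HVz) as [Hper _].
    assert (E := clairaut_sum M (rho (es i)) (fun k => t k i) (fun k => a k i) m n
      ltac:(lia) (Hd i) (fun s => hperiodic (es i) s (proj2 (Hes0 i)))
      (fun s => slope_periodic e0 rho hsmooth hperiodic (es i) s (proj2 (Hes0 i)))
      (Hstep i)).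
    cbv beta in E. unfold t at 1 2, a at 1 2 in E. rewrite Hper in E.
    specialize (E eq_refl eq_refl).
    rewrite <- (Rmult_0_r (/ es i)), <- E, scal_sum. apply sum_eq. intros k _.
    unfold r, r', slope, Rdiv. change (fun s : R => rho (es i) s) with (rho (es i)). ring. }
  assert (Hs0 := radius_ok_sn_pos M rho0 hrho0).
  assert (Hv0 : 0 < speed M rho0 0) by (apply sqrt_lt_R0; nra).
  assert (Lsum : is_lim_seq (fun i => sum_f_R0 (fun k => 2 * sn M (r k i) * sin (a k i)
                     * (r' k i / es i) / speed M (r k i) (r' k i)) (pred n))
     (sum_f_R0 (fun k => 2 * sn M rho0 * sin psi
        * mixed_derivative rho 0 (theta + INR k * alpha) / speed M rho0 0) (pred n))).
  { apply (is_lim_seq_sum_f_R0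
      (fun k i => 2 * sn M (r k i) * sin (a k i) * (r' k i / es i) / speed M (r k i) (r' k i))
      (fun k => 2 * sn M rho0 * sin psi
         * mixed_derivative rho 0 (theta + INR k * alpha) / speed M rho0 0)).
    intros k _. apply is_lim_seq_div'; [repeat apply is_lim_seq_mult'| |lra].
    - apply is_lim_seq_const.
    - exact (is_lim_seq_sn M rho0 (r k) (Lr k)).
    - exact (is_lim_seq_sin psi (a k) (La k)).
    - exact (is_lim_seq_slope_quotient e0 rho0 rho rho1 he0 hsmooth hperiodic hexpansion
               es (t k) _ Hes0 Les (proj1 (Lt k)) (proj2 (Lt k))).
    - exact (is_lim_seq_speed M rho0 (r k) (r' k) hrho0 (Lr k) (Lr' k)). }
  assert (Hlim : sum_f_R0 (fun k => 2 * sn M rho0 * sin psi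
      * mixed_derivative rho 0 (theta + INR k * alpha) / speed M rho0 0) (pred n) = 0).
  { apply Rbar_finite_eq. rewrite <- (is_lim_seq_unique _ _ Lsum).
    rewrite (Lim_seq_ext _ (fun _ => 0)) by exact Hsum. apply Lim_seq_const. }
  assert (Hsin : 0 < sin psi) by (apply sin_gt_0; lra).
  assert (Hc : 0 < 2 * sn M rho0 * sin psi / speed M rho0 0).
  { apply Rdiv_lt_0_compat; [nra|exact Hv0]. }
  apply Rmult_eq_reg_l with (2 * sn M rho0 * sin psi / speed M rho0 0); [|lra].
  rewrite Rmult_0_r. refine (eq_trans _ Hlim).
  rewrite scal_sum. apply sum_eq. intros k _. field. lra.
Qed.

Theorem proposition1 (M : surface) (rho0 : R) (hrho0 : radius_ok M rho0)
  (e0 : R) (he0 : 0 < e0)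
  (rho : R -> R -> R) (rho1 : R -> R)
  (hsmooth : forall (k : nat) (e t : R), Rabs e < e0 -> ex_diff_n rho k e t)
  (hperiodic : forall e t : R, Rabs e < e0 -> rho e (t + 2 * PI) = rho e t)
  (hoval : forall e : R, Rabs e < e0 -> oval M (rho e))
  (hexpansion : exists K d : R, 0 < d /\
     forall e t : R, Rabs e < d ->
       Rabs (rho e t - (rho0 + e * rho1 t)) <= K * e ^ 2)
  (m n : nat) (hn : (2 <= n)%nat) (hm : (0 < m < n)%nat)
  (hgcd : Nat.gcd m n = 1%nat)
  (psi : R) (hpsi : 0 < psi < PI)
  (halpha : rotation_angle M rho0 psi = 2 * PI * INR m / INR n)
  (hfourier : exists j : Z,
     (Z.of_nat n | j)%Z /\ j <> 0%Z /\ fourier_coeff rho1 j <> RtoC 0) :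
  breaks_up (fun e => billiard_map M (rho e)) m n (horizontal_circle psi).
Proof.
  intro Hpers.
  destruct hfourier as (j & Hnj & Hj & Hne). apply Hne. clear Hne.
  assert (Hm0 : 0 < INR m) by (apply lt_0_INR; lia).
  assert (Hn0 : 0 < INR n) by (apply lt_0_INR; lia).
  assert (Halpha : 2 * PI * INR m / INR n <> 0).
  { generalize PI_RGT_0; intro HPI.
    apply Rgt_not_eq, Rdiv_lt_0_compat; [nra|exact Hn0]. }
  apply (fourier_coeff_eq_0 rho1 (mixed_derivative rho 0) m n j); auto; try lia.
  - exact (is_derive_rho1 e0 rho0 rho rho1 he0 hsmooth hexpansion).
  - exact (rho1_periodic e0 rho0 rho rho1 he0 hperiodic hexpansion).
  - apply (persistence_orbit_sum M rho0 hrho0 e0 he0 rho rho1 hsmooth hperiodic)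
      with (m := m) (psi := psi); auto.
    intros e t He. apply (proj1 (hoval e He)).
Qed.
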